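(* Let $\mathbb{F}$ be a field of positive characteristic $p$, let $X$ be a nonempty finite set and let $S=\{R_0,\dots,R_d\}$ be an association scheme on $X$ with thin thin residue, i.e. $O^\vartheta(S)\subseteq O_\vartheta(S)$. Then $S$ is $p$-transitive if and only if $S=\langle S_{p'}\rangle$, where $S_{p'}=\{R_i\in S: p\nmid k_i\}$.
   Context: An association scheme on $X$ is a partition $S=\{R_0,\dots,R_d\}$ of $X\times X$ into nonempty relations such that $R_0=\{(x,x):x\in X\}$; for each $i$ the relation $\{(y,x):(x,y)\in R_i\}$ equals some $R_{i^*}\in S$; and for all $i,j,k$ the number $p_{ij}^k=|\{z\in X:(x,z)\in R_i,(z,y)\in R_j\}|$ does not depend on the choice of $(x,y)\in R_k$. The valency of $R_i$ is $k_i=p_{ii^*}^0$. For nonempty $U,V\subseteq S$, $UV=\{R_k:\exists R_u\in U,R_v\in V,\ p_{uv}^k>0\}$. A nonempty $T\subseteq S$ is closed if $T^*T\subseteq T$ with $T^*=\{R_{i^*}:R_i\in T\}$; strongly normal if also $R_{i^*}TR_i\subseteq T$ for all $i$. For $H\subseteq S$, $\langle H\rangle$ is the intersection of all closed subsets of $S$ containing $H$. $O_\vartheta(S)=\{R_i:k_i=1\}$ (thin radical); $O^\vartheta(S)$ is the intersection of all strongly normal closed subsets (thin residue). Let $A_i$ be the adjacency matrix of $R_i$, $\overline{A_i}$ its image in $M_X(\mathbb{F})$, and $\mathbb{F}S=\mathrm{span}_{\mathbb{F}}\{\overline{A_0},\dots,\overline{A_d}\}$, an algebra with this basis. A trivial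 submodule of the regular $\mathbb{F}S$-module is $\langle v\rangle_{\mathbb{F}}$ with $0\neq v\in\mathbb{F}S$ and $\overline{A_i}v=\overline{k_i}v$ for all $i$ ($\overline{k_i}$ the image of $k_i$ in $\mathbb{F}$). $S$ is $p$-transitive if the regular $\mathbb{F}S$-module has exactly one trivial submodule. *)

(* Defs.v *)
From HB Require Import structures.
From mathcomp Require Import all_boot all_order all_algebra.

Set Implicit Arguments.
Unset Strict Implicit.
Unset Printing Implicit Defensive.

Import GRing.Theory.
Local Open Scope ring_scope.

(* The relations R_0, ..., R_d are indexed by 'I_d.+1; they are pairwise       *)
(* distinct because they are nonempty and pairwise disjoint, so subsets of     *)
(* {R_0, ..., R_d} are encoded as {set 'I_d.+1}. The fields star and inum are  *)
(* uniquely determined by scheme_rel, since every relation is nonempty.        *)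
Record scheme (X : finType) (d : nat) := Scheme {
  scheme_rel :> 'I_d.+1 -> {set X * X};
  star : 'I_d.+1 -> 'I_d.+1;
  inum : 'I_d.+1 -> 'I_d.+1 -> 'I_d.+1 -> nat;
  scheme_neq0 : forall i, scheme_rel i != set0;
  scheme_disjoint : forall i j, i != j -> [disjoint scheme_rel i & scheme_rel j];
  scheme_cover : \bigcup_i scheme_rel i = [set: X * X];
  scheme_diag : scheme_rel ord0 = [set u : X * X | u.1 == u.2];
  scheme_star : forall i,
    scheme_rel (star i) = [set u : X * X | (u.2, u.1) \in scheme_rel i];
  scheme_inum : forall i j k x y, (x, y) \in scheme_rel k ->
    #|[set z | ((x, z) \in scheme_rel i) && ((z, y) \in scheme_rel j)]|
      = inum i j k
}.

Section SchemeTheory.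
Variables (X : finType) (d : nat) (S : scheme X d).
Implicit Types (U V T H : {set 'I_d.+1}) (i : 'I_d.+1).

Definition valency i : nat := inum S i (star S i) ord0.

Definition cprod U V : {set 'I_d.+1} :=
  [set k | [exists u in U, exists v in V, (0 < inum S u v k)%N]].

Definition star_set T : {set 'I_d.+1} := [set star S i | i in T].

Definition closed_subset T : bool :=
  (T != set0) && (cprod (star_set T) T \subset T).

Definition strongly_normal T : bool :=
  closed_subset T &&
  [forall i, cprod (cprod [set star S i] T) [set i] \subset T].

Definition closed_gen H : {set 'I_d.+1} :=
  \bigcap_(T : {set 'I_d.+1} | closed_subset T && (H \subset T)) T.

Definition thin_radical : {set 'I_d.+1} := [set i | valency i == 1%N].

Definition thin_residue : {set 'I_d.+1} :=
  \bigcap_(T : {set 'I_d.+1} | strongly_normal T) T.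

Definition pprime_part (p : nat) : {set 'I_d.+1} :=
  [set i | ~~ (p %| valency i)%N].

(* Rows and columns are indexed by X through the enumeration of X. *)
Definition adjmx i : 'M[int]_#|X| :=
  \matrix_(x, y) ((enum_val x, enum_val y) \in S i)%:R.

Section Algebra.
Variable F : fieldType.

Definition adjmxF i : 'M[F]_#|X| := map_mx (fun z : int => z%:~R) (adjmx i).

Definition adj_alg : {vspace 'M[F]_#|X|} :=
  <<[seq adjmxF i | i <- enum 'I_d.+1]>>%VS.

Definition trivial_submodule (W : {vspace 'M[F]_#|X|}) : Prop :=
  exists v : 'M[F]_#|X|,
    [/\ v != 0, v \in adj_alg,
        forall i, adjmxF i *m v = (valency i)%:R *: v
      & W = <[v]>%VS].

(* Here p is the characteristic of F. *)
Definition p_transitive : Prop :=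
  exists! W : {vspace 'M[F]_#|X|}, trivial_submodule W.

End Algebra.
End SchemeTheory.

(* Main.v *)
Require Import Defs.
From HB Require Import structures.
From mathcomp Require Import all_boot all_order all_algebra.

(** Write [r(x,y)] for the relation containing [(x,y)].  For each [i] the set
    [i* i] lies in the thin residue [N], so any two points of [x R_i] differ by
    an element of [N], and [N] consists of thin relations.

    If [T] is a closed subset containing [S_p'], it contains all thin relations,
    hence [N]; thus [x R_i] lies in a single [T]-class, and the 0-1 matrix [v_T]
    of the equivalence relation [r(x,y) \in T] satisfies [A_i v_T = k_i v_T],
    both sides being [0] when [i] is outside [T] since then [p] divides [k_i].
    For [T = <S_p'>] and [T = S] this gives two trivial submodules, equal only
    if [T = S].

    Conversely let [A_i v = k_i v] for all [i].  Thin [i] show that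
    [x |-> v x y] is constant on [N]-classes, hence on each [x R_i]; if [p] does
    not divide [k_i], then [A_i v = k_i v] gives [v x y = v z y] for [(x,z)] in
    [R_i].  The relations with this last property form a closed subset, so if
    [S = <S_p'>] then [v x y = v y y], which is the coefficient of [A_0]. *)

Set Implicit Arguments.
Unset Strict Implicit.
Unset Printing Implicit Defensive.

Import GRing.Theory.
Local Open Scope ring_scope.

(** * Relations of the scheme as a function of pairs of points *)

Section Scheme.
Variables (X : finType) (d : nat) (S : scheme X d).
Implicit Types (T H : {set 'I_d.+1}) (i : 'I_d.+1) (x y z : X).

(** The default [ord0] is never reached, because the relations cover all pairs. *)
Definition relix x y : 'I_d.+1 := odflt ord0 [pick i | (x, y) \in S i].

Lemma in_scheme_rel i x y : ((x, y) \in S i) = (relix x y == i).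
Proof.
rewrite /relix; case: pickP => [j xyj | noi] /=; last first.
  have: (x, y) \in \bigcup_i S i by rewrite scheme_cover inE.
  by case/bigcupP => k _; rewrite noi.
apply/idP/eqP => [xyi | <- //]; apply/eqP/negPn/negP => /(scheme_disjoint S).
by move/disjointFr => /(_ _ xyj); rewrite xyi.
Qed.

Lemma relix_surj i : exists x y, relix x y = i.
Proof.
have /set0Pn[[x y]] := scheme_neq0 S i.
by rewrite in_scheme_rel => /eqP; exists x, y.
Qed.

Lemma relix0 x y : (relix x y == ord0) = (x == y).
Proof. by rewrite -in_scheme_rel scheme_diag inE. Qed.

Lemma relixx x : relix x x = ord0.
Proof. by apply/eqP; rewrite relix0. Qed.

Lemma relixC x y : relix y x = star S (relix x y).
Proof. by apply/eqP; rewrite -in_scheme_rel scheme_star inE in_scheme_rel /=. Qed.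

Lemma starK : involutive (star S).
Proof. by move=> i; have [x [y <-]] := relix_surj i; rewrite -!relixC. Qed.

Lemma inum_gt0P i j x y :
  reflect (exists2 z, relix x z = i & relix z y = j)
          (0 < inum S i j (relix x y))%N.
Proof.
have xy : (x, y) \in S (relix x y) by rewrite in_scheme_rel.
rewrite -(scheme_inum i j xy) card_gt0.
apply: (iffP (set0Pn _)) => [[z] | [z xz zy]].
  by rewrite inE !in_scheme_rel => /andP[/eqP xz /eqP zy]; exists z.
by exists z; rewrite inE !in_scheme_rel xz zy !eqxx.
Qed.

Lemma card_neighbours i x : #|[set z | relix x z == i]| = valency S i.
Proof.
have xx : (x, x) \in S ord0 by rewrite in_scheme_rel relixx.
rewrite /valency -(scheme_inum i (star S i) xx); apply: eq_card => z.
by rewrite !inE scheme_star inE /= andbb in_scheme_rel.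
Qed.

(** Read on points, the inclusion T*T in T is the Euclidean property; as [T] then contains [ord0],
    it makes r(x,y) in [T] an equivalence relation on X. *)
Lemma closed_subsetP T :
  reflect (T != set0 /\ forall x y z,
             relix x y \in T -> relix x z \in T -> relix y z \in T)
          (closed_subset S T).
Proof.
apply: (iffP andP) => -[T0 clT]; split=> //.
  move=> x y z xyT xzT; apply: (subsetP clT); rewrite inE.
  apply/exists_inP; exists (star S (relix x y)); first exact: imset_f.
  apply/exists_inP; exists (relix x z) => //.
  by apply/inum_gt0P; exists x; rewrite // -relixC.
apply/subsetP => k; have [x [y <-]] := relix_surj k; rewrite inE.
case/exists_inP => _ /imsetP[a aT ->] /exists_inP[b bT] /inum_gt0P[z xz zy].
by apply: (clT z); rewrite ?zy // relixC xz starK.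
Qed.

Lemma closed_subset0 T : closed_subset S T -> ord0 \in T.
Proof.
case/closed_subsetP=> /set0Pn[t tT] clT; have [x [y xy]] := relix_surj t.
by rewrite -(relixx y); apply: (clT x); rewrite xy.
Qed.

Lemma closed_subsetT : closed_subset S setT.
Proof.
apply/closed_subsetP; split=> [|x y z]; last by rewrite !inE.
by apply/set0Pn; exists ord0; rewrite inE.
Qed.

Lemma sub_closed_gen H : H \subset closed_gen S H.
Proof. by apply/bigcapsP => T /andP[]. Qed.

Lemma closed_gen_min H T :
  closed_subset S T -> H \subset T -> closed_gen S H \subset T.
Proof. by move=> clT HT; apply: bigcap_inf; rewrite clT. Qed.

Lemma closed_gen_closed H : closed_subset S (closed_gen S H).
Proof.
apply/closed_subsetP; split=> [|x y z /bigcapP xy /bigcapP xz].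
  apply/set0Pn; exists ord0; apply/bigcapP => T /andP[clT _].
  exact: closed_subset0.
apply/bigcapP => T PT; have /andP[/closed_subsetP[_ clT] _] := PT.
by apply: (clT x); [apply: xy | apply: xz].
Qed.

(** For i = r(x,y) = r(x,z), the path y, x, x, z puts r(y,z) in i* R_0 i, and this lies in i* T i
    for each strongly normal [T]. *)
Lemma relix_thin_residue x y z :
  relix x y = relix x z -> relix y z \in thin_residue S.
Proof.
move=> xyz; apply/bigcapP => T /andP[clT /forallP/(_ (relix x y)) nT].
apply: (subsetP nT); rewrite inE.
apply/exists_inP; exists (star S (relix x y)).
  rewrite inE; apply/exists_inP; exists (star S (relix x y)); rewrite ?inE //.
  apply/exists_inP; exists ord0; first exact: closed_subset0.
  by rewrite -relixC; apply/inum_gt0P; exists x; rewrite ?relixx.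
apply/exists_inP; exists (relix x y); rewrite ?inE //.
by apply/inum_gt0P; exists x; rewrite // -relixC.
Qed.

(** * The adjacency algebra and its class matrices *)

Section Algebra.
Variable F : fieldType.
Local Notation A := (adjmxF S F).

Lemma adjmxFE i a b : A i a b = (relix (enum_val a) (enum_val b) == i)%:R.
Proof. by rewrite !mxE in_scheme_rel; case: eqP. Qed.

(** Each A_i has constant diagonal, a property that passes to linear combinations. *)
Lemma adj_alg_diag (v : 'M[F]_#|X|) a b : v \in adj_alg S F -> v a a = v b b.
Proof.
move/(@coord_span _ _ _ (in_tuple _)) => ->; rewrite !summxE.
apply: eq_bigr => i _; rewrite !mxE; congr (_ * _).
have lt_i : (i < size (enum 'I_d.+1))%N by rewrite -(size_map A).
by rewrite (nth_map ord0) // !adjmxFE !relixx.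
Qed.

Lemma adjmxF_mulE i (v : 'M[F]_#|X|) a b :
  (A i *m v) a b
    = \sum_(z | relix (enum_val a) z == i) v (enum_rank z) b.
Proof.
rewrite mxE (reindex_onto enum_rank enum_val) /=; last by move=> c; rewrite enum_valK.
rewrite [RHS]big_mkcond; apply: eq_big => [z|z _]; first by rewrite enum_rankK eqxx.
by rewrite adjmxFE enum_rankK; case: eqP => _; rewrite ?mul1r ?mul0r.
Qed.

Lemma sumr_neighbours i x (c : F) :
  \sum_(z | relix x z == i) c = (valency S i)%:R * c.
Proof. by rewrite sumr_const mulr_natl -(card_neighbours i x) cardsE. Qed.

(** This is v_T, and for [setT] the all-one matrix; written as a sum, it visibly lies in the
    algebra. *)
Definition classmx T : 'M[F]_#|X| := \sum_(i in T) A i.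

Lemma classmxE T a b :
  classmx T a b = (relix (enum_val a) (enum_val b) \in T)%:R.
Proof.
rewrite summxE; under eq_bigr do rewrite adjmxFE.
case: (boolP (_ \in T)) => [abT | abNT]; last first.
  by rewrite big1 // => i iT; case: eqP => // abi; rewrite abi iT in abNT.
rewrite (bigD1 _ abT) /= eqxx big1 ?addr0 // => i /andP[_ /negPf].
by rewrite eq_sym => ->.
Qed.

Lemma classmx_in_adj_alg T : classmx T \in adj_alg S F.
Proof. by apply: memv_suml => i _; apply/memv_span/map_f; rewrite mem_enum. Qed.

(** * Trivial submodules when the thin residue is thin *)

Section ThinThinResidue.
Variable p : nat.
Hypotheses (charF : p \in [pchar F]) (X_gt0 : (0 < #|X|)%N).
Hypothesis thinN : thin_residue S \subset thin_radical S.

Lemma thin_radical_sub_pprime : thin_radical S \subset pprime_part S p.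
Proof.
apply/subsetP => i; rewrite !inE => /eqP->; rewrite dvdn1.
by case: eqP (pcharf_prime charF) => // ->.
Qed.

Lemma classmx_trivial T :
  closed_subset S T -> pprime_part S p \subset T ->
  forall i, A i *m classmx T = (valency S i)%:R *: classmx T.
Proof.
move=> /closed_subsetP[T0 clT] sT i.
have T_0 : ord0 \in T by apply: closed_subset0; apply/closed_subsetP.
have symT x y : relix x y \in T -> relix y x \in T.
  by move=> xyT; apply: (clT x); rewrite ?relixx.
have sNT j : j \in thin_residue S -> j \in T.
  by move=> /(subsetP thinN)/(subsetP thin_radical_sub_pprime)/(subsetP sT).
apply/matrixP => a b; rewrite adjmxF_mulE mxE.
set x := enum_val a; set y := enum_val b.
(* If x R_i were empty, k_i would be 0 and both sides would vanish. *)
have [z0 xz0 | noz] := pickP (fun z => relix x z == i); last first.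
  rewrite big_pred0 // -(card_neighbours i x) (_ : [set _ | _] = set0).
    by rewrite cards0 mul0r.
  by apply/setP => z; rewrite !inE noz.
transitivity (\sum_(z | relix x z == i) (relix z0 y \in T)%:R : F).
  apply: eq_bigr => z xz; rewrite classmxE enum_rankK -/y.
  have zz0 : relix z z0 \in T.
    by apply/sNT/(@relix_thin_residue x); rewrite (eqP xz) (eqP xz0).
  congr (_%:R); congr nat_of_bool; apply/idP/idP; first exact: clT.
  by apply: clT; apply: symT.
rewrite sumr_neighbours classmxE -/x -/y.
have [iT | iNT] := boolP (i \in T).
  have xz0T : relix x z0 \in T by rewrite (eqP xz0).
  congr (_ * _%:R); congr nat_of_bool; apply/idP/idP; last exact: clT.
  by apply: clT; apply: symT.
suff /eqP-> : (valency S i)%:R == 0 :> F by rewrite !mul0r.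
rewrite -(dvdn_pcharf charF); apply: contraNT iNT => pNi.
by apply: (subsetP sT); rewrite inE.
Qed.

Lemma classmx_neq0 T : closed_subset S T -> classmx T != 0.
Proof.
move=> clT; apply/eqP => /matrixP /(_ (Ordinal X_gt0) (Ordinal X_gt0)) /eqP.
by rewrite classmxE mxE relixx closed_subset0 // oner_eq0.
Qed.

Lemma classmx_trivial_submodule T :
  closed_subset S T -> pprime_part S p \subset T ->
  trivial_submodule S <[classmx T]>%VS.
Proof.
move=> clT sT; exists (classmx T); split=> //; first exact: classmx_neq0.
  exact: classmx_in_adj_alg.
exact: classmx_trivial.
Qed.

Lemma trivial_vector_const (v : 'M[F]_#|X|) :
  [set: 'I_d.+1] = closed_gen S (pprime_part S p) ->
  v \in adj_alg S F ->
  (forall i, A i *m v = (valency S i)%:R *: v) ->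
  exists c, v = c *: classmx setT.
Proof.
move=> genS v_in vP.
pose f z b := v (enum_rank z) b.
have avg i x b :
    \sum_(z | relix x z == i) f z b = (valency S i)%:R * f x b.
  by have /matrixP/(_ (enum_rank x) b) := vP i; rewrite adjmxF_mulE enum_rankK mxE.
have fthin x z b : relix x z \in thin_radical S -> f x b = f z b.
  rewrite inE => /eqP k1; have := avg (relix x z) x b.
  have /eqP/cards1P[w xw] : #|[set u | relix x u == relix x z]| = 1%N.
    by rewrite card_neighbours.
  have : z \in [set w] by rewrite -xw inE.
  rewrite inE k1 mul1r => /eqP zw <-; rewrite (big_pred1 z) // => u /=.
  by move/setP/(_ u): xw; rewrite !inE zw.
(* By [fthin], f is constant on x R_i, so [avg] reads k_i f(z) = k_i f(x), where k_i is invertible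
   in [F]. *)
have fpp x z b : relix x z \in pprime_part S p -> f x b = f z b.
  rewrite inE (dvdn_pcharf charF) => k_neq0; apply: (mulfI k_neq0).
  rewrite -avg -(sumr_neighbours _ x); apply: eq_bigr => u /eqP xu.
  exact/fthin/(subsetP thinN)/(@relix_thin_residue x).
pose T := [set i | [forall x, forall z, (relix x z == i) ==>
                     [forall b, f x b == f z b]]].
have T_P x z b : relix x z \in T -> f x b = f z b.
  rewrite inE => /forallP/(_ x)/forallP/(_ z)/implyP/(_ (eqxx _)).
  by move=> /forallP/(_ b)/eqP.
have in_T i : (forall x z b, relix x z = i -> f x b = f z b) -> i \in T.
  move=> iP; rewrite inE; apply/forallP => x; apply/forallP => z.
  by apply/implyP => /eqP xz; apply/forallP => b; apply/eqP/iP.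
have sppT : pprime_part S p \subset T.
  by apply/subsetP => i ipp; apply: in_T => x z b xz; apply: fpp; rewrite xz.
have clT : closed_subset S T.
  apply/closed_subsetP; split=> [|x y z xyT xzT].
    by apply/set0Pn; exists ord0; apply: in_T => x z b /eqP; rewrite relix0 => /eqP->.
  apply: in_T => y' z' b yz'.
  (* Membership in [T] concerns every pair (y',z') in the relation of (y,z). Intersection numbers
     depend only on that relation, so the intermediate point x has a counterpart x' for (y',z'). *)
  have /inum_gt0P[x' yx' xz'] :
      (0 < inum S (relix y x) (relix x z) (relix y' z'))%N.
    by rewrite yz'; apply/inum_gt0P; exists x.
  rewrite -(T_P x' y') -?(T_P x' z') ?xz' //.
  by rewrite relixC yx' -relixC.
have fC x z b : f x b = f z b.
  apply: T_P; apply: (subsetP (closed_gen_min clT sppT)).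
  by rewrite -genS inE.
pose a0 := Ordinal X_gt0.
(* Column b is constant, hence equal to its diagonal entry, and all diagonal entries of v agree. *)
exists (v a0 a0); apply/matrixP => a b; rewrite mxE classmxE inE mulr1.
rewrite (adj_alg_diag a0 b v_in).
by have := fC (enum_val a) (enum_val b) b; rewrite /f !enum_valK.
Qed.

End ThinThinResidue.
End Algebra.
End Scheme.

Theorem theoremB (F : fieldType) (p : nat) (hp : p \in [pchar F])
    (X : finType) (hX : (0 < #|X|)%N) (d : nat) (S : scheme X d)
    (hS : thin_residue S \subset thin_radical S) :
  p_transitive S F <-> [set: 'I_d.+1] = closed_gen S (pprime_part S p).
Proof.
have trivS : trivial_submodule S <[classmx S F setT]>%VS.
  by apply: (classmx_trivial_submodule hp); rewrite ?closed_subsetT ?subsetT.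
split=> [[W [_ W_uniq]] | genS].
  set T := closed_gen S _; have clT : closed_subset S T := closed_gen_closed S _.
  have trivT : trivial_submodule S <[classmx S F T]>%VS.
    by apply: (classmx_trivial_submodule hp); rewrite ?sub_closed_gen.
  have /vlineP[c TE] : classmx S F T \in <[classmx S F setT]>%VS.
    by rewrite -(W_uniq _ trivS) (W_uniq _ trivT) memv_line.
  (* Proportionality to the all-one matrix makes the indicator of [T] constant; on the diagonal it
     is 1. *)
  have TEc x y : (relix S x y \in T)%:R = c.
    have /matrixP/(_ (enum_rank x) (enum_rank y)) := TE.
    by rewrite mxE !classmxE !enum_rankK inE mulr1.
  apply/setP => i; have [x [y <-]] := relix_surj S i; rewrite inE.
  have := TEc x y; rewrite -(TEc x x) relixx (closed_subset0 clT).
  by case: (_ \in T) => // /eqP; rewrite eq_sym oner_eq0.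
exists <[classmx S F setT]>%VS; split=> // _ [v [v_neq0 v_in vP ->]].
have [c vE] := trivial_vector_const hp hX hS genS v_in vP.
have c_neq0 : c != 0 by apply: contraNneq v_neq0 => c0; rewrite vE c0 scale0r.
apply/eqP; rewrite eqEsubv -!memvE vE memvZ ?memv_line // andbT.
by apply/vlineP; exists c^-1; rewrite scalerA mulVf ?scale1r.
Qed.
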